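(* Let $n\geq 1$ be an integer, let $0\leq\mu_1\leq\cdots\leq\mu_n$ be real numbers, and let $\lambda>\sum_{i=1}^n\mu_i$. Define $$c(\bm{\mu},\lambda):=\inf\ \mathbb{P}\left(\sum_{i=1}^n X_i<\lambda\right),$$ where the infimum is over all independent nonnegative real random variables $X_1,\ldots,X_n$ with $\mathbb{E}X_i=\mu_i$ for $1\leq i\leq n$. Then $$c(\bm{\mu},\lambda)=\min_{1\leq i\leq n}\ \prod_{j=i}^n\left(1-\frac{\mu_j}{\lambda-\sum_{k=1}^{i-1}\mu_k}\right).$$ Moreover the bound is sharp and is attained: there exist independent nonnegative random variables $X_1,\ldots,X_n$ with $\mathbb{E}X_i=\mu_i$ for which $\mathbb{P}\left(\sum_{i=1}^n X_i<\lambda\right)$ equals the right-hand side.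
   Context: Here $\bm{\mu}=(\mu_1,\ldots,\mu_n)$. The infimum ranges over all choices of the laws of $X_1,\ldots,X_n$, i.e. over all product measures $\nu_1\otimes\cdots\otimes\nu_n$ where $\nu_i$ is a Borel probability measure on $[0,\infty)$ with mean $\mu_i$. Empty sums are $0$, so for $i=1$ the denominator is $\lambda$. *)

(* Defs.v *)
From HB Require Import structures.
From mathcomp Require Import all_boot all_order all_algebra.
From mathcomp Require Import all_classical all_reals all_analysis.

Set Implicit Arguments.
Unset Strict Implicit.
Unset Printing Implicit Defensive.

Import Order.TTheory GRing.Theory Num.Theory.
Import numFieldNormedType.Exports.

Local Open Scope classical_set_scope.
Local Open Scope ring_scope.

Definition mutually_independent (R : realType) (n : nat) (d : measure_display)
    (T : measurableType d) (P : probability T R)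
    (X : 'I_n -> {RV P >-> R}) : Prop :=
  forall (J : {set 'I_n}) (B : 'I_n -> set R),
    (forall i, measurable (B i)) ->
    P [set w | forall i, i \in J -> B i (X i w)] =
    (\prod_(i in J) P (X i @^-1` B i))%E.

(* An expectation equal to (mu i)%:E is finite, so integrability of the
   nonnegative X i need not be required separately. *)
Definition indep_nneg_with_means (R : realType) (n : nat) (mu : 'I_n -> R)
    (d : measure_display) (T : measurableType d) (P : probability T R)
    (X : 'I_n -> {RV P >-> R}) : Prop :=
  [/\ mutually_independent X,
      (forall i w, 0 <= X i w) &
      (forall i, 'E_P[X i] = (mu i)%:E)%E].

Definition prob_sum_lt (R : realType) (n : nat) (lambda : R)
    (d : measure_display) (T : measurableType d) (P : probability T R)
    (X : 'I_n -> {RV P >-> R}) : \bar R :=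
  P [set w | \sum_(i < n) X i w < lambda].

(* The underlying probability space varies together with the variables. *)
Definition attainable_probs (R : realType) (n : nat) (mu : 'I_n -> R)
    (lambda : R) : set (\bar R) :=
  [set p | exists (d : measure_display) (T : measurableType d)
      (P : probability T R) (X : 'I_n -> {RV P >-> R}),
      indep_nneg_with_means mu X /\ prob_sum_lt lambda X = p].

Definition c_inf (R : realType) (n : nat) (mu : 'I_n -> R) (lambda : R) :
    \bar R :=
  ereal_inf (attainable_probs mu lambda).

Definition tail_product (R : realType) (n : nat) (mu : 'I_n -> R) (lambda : R)
    (i : 'I_n) : R :=
  \prod_(j < n | (i <= j)%N)
    (1 - mu j / (lambda - \sum_(k < n | (k < i)%N) mu k)).

(* The minimum is taken in \bar R so that the unit +oo of mine makes it the
   genuine minimum over the index set whenever 0 < n. *)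
Definition min_tail_product (R : realType) (n : nat) (mu : 'I_n -> R)
    (lambda : R) : \bar R :=
  \big[mine/+oo%E]_(i < n) (tail_product mu lambda i)%:E.

(* Main.v *)
Require Import Defs.
From HB Require Import structures.
From mathcomp Require Import all_boot all_order all_algebra.
From mathcomp Require Import all_classical all_reals all_analysis.
From mathcomp Require Import measurable_realfun perm ring lra.
Import Order.TTheory GRing.Theory Num.Theory.
Import numFieldNormedType.Exports.
Local Open Scope ring_scope.

(** Rounding down to a grid and writing every finite law as a mixture of
    two-point laws with the same mean reduces the lower bound to sums
    [S = \sum_i w_i xi_i] with independent Bernoulli [xi_i]; the lower of the
    two values of each variable is subtracted from [lambda], which decreases
    the means but not [d = lambda - E S]. Put [f = P(S < lambda)],
    [e = E (lambda - S)_+] and [beta = f / e].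

    Some variable can be replaced by [0] without increasing [beta]: conditionally
    on [S < lambda], the covariances of [S] with the [xi_i], weighted by the
    [w_i], add up to the variance of [S], so one of them is nonnegative. As in
    Wald's identity, this replacement increases [e] by at most
    [m_i P(S - w_i xi_i < lambda)], where [m_i = E (w_i xi_i)], that is, [e] is
    at least [1 - beta m_i] times its new value. Removing variables one after
    the other, and only partially the last one, until
    [beta^-1 = d + \sum_i m'_i], where [0 <= m' <= m] is the vector of the
    removed means, gives [f = beta e >= \prod_i (1 - m'_i / (d + \sum_j m'_j))].

    In a single coordinate of [m'] the right-hand side is a product of positive
    affine functions of [(d + \sum_j m'_j)^-1], so it is quasi-concave and may
    be decreased by moving that coordinate to an end of any interval [[0, u]].
    This leads to [m'_i] in [{0, mu_i}], and then to [m'] carried by the largest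
    means. *)

(** * Quasi-concavity of products of affine functions *)

Section QuasiConcave.
Context {R : realType}.

(** With [s i] the relative slope, the end factors are [l i * (1 + t * s i)] and
    [l i * (1 + (t - 1) * s i)]. Since [1 + x <= expR x], an end whose coefficient [c] satisfies
    [c * \sum_i s i <= 0] has the smaller product. *)
Lemma prod_affine_quasiconcave (I : finType) (l0 l1 l : I -> R) (t : R) :
  0 <= t <= 1 -> (forall i, 0 <= l0 i) -> (forall i, 0 <= l1 i) ->
  (forall i, 0 < l i) -> (forall i, l i = (1 - t) * l0 i + t * l1 i) ->
  \prod_i l0 i <= \prod_i l i \/ \prod_i l1 i <= \prod_i l i.
Proof.
move=> /andP[t0 t1] l00 l10 l_gt0 lE.
pose s i := (l0 i - l1 i) / l i.
have bound (c : R) (u : I -> R) : (forall i, 0 <= u i) ->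
    (forall i, u i = l i * (1 + c * s i)) -> c * \sum_i s i <= 0 ->
    \prod_i u i <= \prod_i l i.
  move=> u0 uE cs; rewrite (eq_bigr _ (fun i _ => uE i)) big_split /=.
  rewrite ler_piMr ?prodr_ge0 // => [i _|]; first exact/ltW.
  apply: (@le_trans _ _ (\prod_i expR (c * s i))).
    apply: ler_prod => i _; rewrite expR_ge1Dx andbT.
    by have := u0 i; rewrite uE pmulr_rge0.
  by rewrite -expR_sum -mulr_sumr -expR0 ler_expR.
have lN0 i : l i != 0 by rewrite gt_eqF.
have [S0|S0] := leP (\sum_i s i) 0.
- left; apply: (bound t) => // [i|]; last by rewrite mulr_ge0_le0.
  by rewrite /s mulrDr mulr1 mulrCA [l i * _]mulrC divfK// {1}lE; ring.
- right; apply: (bound (t - 1)) => // [i|].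
    by rewrite /s mulrDr mulr1 mulrCA [l i * _]mulrC divfK// {1}lE; ring.
  by rewrite mulr_le0_ge0 ?subr_le0// ltW.
Qed.

End QuasiConcave.

(** * Minimising the null probability over a box of means *)

Section Box.
Context {R : realType} {n : nat}.
Implicit Types (d : R) (m mu : 'I_n -> R).

(* The probability that a sum of independent variables with values [0] and
   [d + \sum_i m i] and means [m i] stays below [d + \sum_i m i]. *)
Definition null_prob d m : R := \prod_i (1 - m i / (d + \sum_j m j)).

Definition upd m i (x : R) : 'I_n -> R :=
  fun j => if j == i then x else m j.

Lemma sum_upd m i x : \sum_j upd m i x j = x + \sum_(j | j != i) m j.
Proof.
rewrite (bigD1 i)//= /upd eqxx; congr (_ + _).
by apply: eq_bigr => j /negbTE ->.
Qed.

Lemma null_prob_ext d m m' : m =1 m' -> null_prob d m = null_prob d m'.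
Proof.
move=> mm'; rewrite /null_prob (eq_bigr _ (fun i _ => mm' i)).
by apply: eq_bigr => i _; rewrite mm'.
Qed.

(** Let [C] be [d] plus the other means. In terms of [y = (C + x)^-1], with [x] the mean at [i],
    factor [i] is [C * y] and the others are [1 - m j * y], all affine in [y]. *)
Lemma null_prob_upd d m i u : 0 < d -> (forall j, 0 <= m j) -> m i <= u ->
  null_prob d (upd m i 0) <= null_prob d m \/
  null_prob d (upd m i u) <= null_prob d m.
Proof.
move=> d0 m0 miu; set C := d + \sum_(j | j != i) m j.
have C0 : 0 < C by rewrite ltr_pwDl// sumr_ge0.
pose l (y : R) j := if j == i then C * y else 1 - m j * y.
have updE x : 0 <= x -> null_prob d (upd m i x) = \prod_j l (C + x)^-1 j.
  move=> x0; rewrite /null_prob sum_upd addrCA [x + _]addrC -/C.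
  apply: eq_bigr => j _; rewrite /upd /l; case: eqP => // _.

  by field; rewrite gt_eqF// ltr_wpDr.
have lt1 x j : 0 <= x -> j != i -> 0 < 1 - m j * (C + x)^-1.
  move=> x0 ji; have Cx0 : 0 < C + x by rewrite ltr_wpDr.
  rewrite subr_gt0 ltr_pdivrMr// mul1r ltr_wpDr// /C (bigD1 j)//= addrCA.
  by rewrite ltr_pwDr// ltr_wpDr// sumr_ge0.
have l_gt0 x j : 0 <= x -> 0 < l (C + x)^-1 j.
  move=> x0; rewrite /l; case: eqVneq => [_|ji]; last exact: lt1.
  by rewrite mulr_gt0// invr_gt0 ltr_wpDr.
have mE : null_prob d m = \prod_j l (C + m i)^-1 j.
  by rewrite -updE//; apply: null_prob_ext => j; rewrite /upd; case: eqP => [->|].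
have u0 : 0 <= u := le_trans (m0 i) miu.
rewrite mE !updE//.
have [u00|uN0] := eqVneq u 0.
  by left; rewrite (_ : m i = 0)//; apply/eqP; rewrite eq_le m0 andbT -u00.
have Cx x : 0 <= x -> C + x != 0 by move=> x0; rewrite gt_eqF// ltr_wpDr.
(* This weight makes [(C + m i)^-1] the convex combination of [C^-1] and [(C + u)^-1]. *)
apply: (@prod_affine_quasiconcave R _ _ _ _ (m i / u * ((C + u) / (C + m i)))).
- have u_gt0 : 0 < u by rewrite lt_neqAle eq_sym uN0.
  have Cm : 0 < C + m i by rewrite ltr_wpDr.
  have Cu : 0 < C + u by rewrite ltr_wpDr.
  rewrite mulr_ge0 ?divr_ge0 ?(ltW Cm) ?(ltW Cu)//= mulf_div.
  rewrite ler_pdivrMr ?mulr_gt0// mul1r !mulrDr.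
  by rewrite [u * m i]mulrC lerD2r -!mulrDr ler_wpM2r// ltW.
- by move=> j; rewrite ltW// l_gt0.
- by move=> j; rewrite ltW// l_gt0.
- by move=> j; rewrite l_gt0.
- move=> j; rewrite /l; case: eqP => _.
    by field; rewrite ?uN0 ?Cx // gt_eqF.
  by field; rewrite ?uN0 ?Cx // gt_eqF.
Qed.

Definition restr m (A : {set 'I_n}) : 'I_n -> R :=
  fun i => if i \in A then m i else 0.

(** Each use of [null_prob_upd] moves one more coordinate to an end of its interval, so the number
    of intermediate coordinates drops. *)
Lemma null_prob_vertex d m mu : 0 < d -> (forall i, 0 <= m i <= mu i) ->
  exists A, null_prob d (restr mu A) <= null_prob d m.
Proof.
move=> d0; have [k] := ubnP #|[set i | (m i != 0) && (m i != mu i)]|.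
elim: k m => // k IH m; rewrite ltnS => mk mb.
have mu0 i : 0 <= mu i by have /andP[/le_trans h /h] := mb i.
have [i /andP[i0 i1]|none] := pickP [pred i | (m i != 0) && (m i != mu i)].
  have shrink x : (x == 0) || (x == mu i) -> exists A,
      null_prob d (restr mu A) <= null_prob d (upd m i x).
    move=> x0; apply: IH => [|j]; last first.
      rewrite /upd; case: eqP => [->|_]; last exact: mb.
      by case/orP: x0 => /eqP ->; rewrite lexx mu0.
    apply: leq_trans mk; apply: proper_card; apply/properP; split.
      apply/fintype.subsetP => j; rewrite !inE /upd; case: (j =P i) => [->|//].
      by case/orP: x0 => /eqP ->; rewrite eqxx ?andbF.
    exists i; rewrite !inE ?i0 ?i1// /upd eqxx.
    by case/orP: x0 => /eqP ->; rewrite eqxx ?andbF.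
  have [] := @null_prob_upd d m i (mu i) d0 (fun j => (andP (mb j)).1)
    (andP (mb i)).2; move=> le.
    by have [|A hA] := shrink 0; rewrite ?eqxx//; exists A; apply: le_trans le.
  have [|A hA] := shrink (mu i); first by rewrite eqxx orbT.
  by exists A; apply: le_trans le.
exists [set i | m i != 0]; rewrite le_eqVlt; apply/orP; left; apply/eqP.
apply: null_prob_ext => i; rewrite /restr inE.
by case: eqP => //= m_i0; have /= := none i; case: eqP => //= _ /negbFE/eqP.
Qed.

Lemma null_prob_perm d m (s : {perm 'I_n}) : null_prob d (m \o s) = null_prob d m.
Proof.
have -> : null_prob d m = \prod_i (1 - m (s i) / (d + \sum_j m j)).
  by rewrite /null_prob (reindex_inj (@perm_inj _ s)).
by rewrite /null_prob [\sum_j m j](reindex_inj (@perm_inj _ s)).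
Qed.

(** If [j] lies in [A] and a larger [i] does not, the mean at [j] is moved to an end of [[0, mu i]].
    At [0] the set loses [j]; at [mu i] a transposition exchanges [j] for [i] in [A]. The potential
    [\sum_(l in A) (n - l)] drops either way. *)
Lemma null_prob_suffix d mu A : 0 < d -> (forall i, 0 <= mu i) ->
  (forall i j : 'I_n, (i <= j)%N -> mu i <= mu j) ->
  exists k, null_prob d (restr mu [set i : 'I_n | (k <= i)%N]) <=
            null_prob d (restr mu A).
Proof.
move=> d0 mu0 mono; have [k] := ubnP (\sum_(i in A) (n - i)).
elim: k A => // k IH A; rewrite ltnS => mk.
have [[j i] /= /and3P[jA iA ji]|none] :=
  pickP [pred x : 'I_n * 'I_n | [&& x.1 \in A, x.2 \notin A & (x.1 < x.2)%N]].
  have lower (B : {set 'I_n}) :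
      (\sum_(l in B) (n - l) < \sum_(l in A) (n - l))%N ->
      null_prob d (restr mu B) <= null_prob d (restr mu A) ->
      exists k, null_prob d (restr mu [set i : 'I_n | (k <= i)%N]) <=
            null_prob d (restr mu A).
    move=> hB le; have [k' hk'] := IH B (leq_trans hB mk).
    by exists k'; exact: le_trans le.
  have sumA : (\sum_(l in A) (n - l) = (n - j) + \sum_(l in A :\ j) (n - l))%N.
    by rewrite (big_setD1 j).
  have nj : (0 < n - j)%N by rewrite subn_gt0.
  have [] := @null_prob_upd d (restr mu A) j (mu i) d0.
  - by move=> l; rewrite /restr; case: ifP.
  - by rewrite /restr jA mono// ltnW.
  - rewrite (_ : null_prob d _ = null_prob d (restr mu (A :\ j))).
      by apply: lower; rewrite sumA -[X in (X < _)%N]add0n ltn_add2r.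
    by apply: null_prob_ext => l; rewrite /upd /restr !inE; case: eqP.
  - rewrite (_ : null_prob d _ = null_prob d (restr mu (i |: A :\ j))).
      apply: lower; rewrite sumA big_setU1/= ?ltn_add2r ?ltn_sub2l//.
      by rewrite !inE (negbTE iA) andbF.
    rewrite -(null_prob_perm _ _ (tperm i j)); apply: null_prob_ext => l /=.
    rewrite /upd /restr; case: tpermP => [->|->|/eqP li /eqP lj].
    + by rewrite eqxx !inE eqxx.
    + have ij : i != j by apply: contraNneq iA => ->.
      by rewrite (negbTE ij) (negbTE iA) !inE eqxx eq_sym (negbTE ij).
    + by rewrite (negbTE lj) !inE (negbTE li) lj.
(* No such pair is left, so [A] is upward closed: empty, with [k = n], or all indices from its least
   element on. *)
have [->|[x xA]] := set_0Vmem A.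
  exists n; rewrite le_eqVlt; apply/orP; left; apply/eqP.
  apply: null_prob_ext => i; rewrite /restr !inE.
  by rewrite leqNgt ltn_ord.
have [x0 x0A x0m] := arg_minnP (fun i : 'I_n => i : nat) xA.
have {}x0A : x0 \in A := x0A.
exists x0; rewrite le_eqVlt; apply/orP; left; apply/eqP.
apply: null_prob_ext => i; rewrite /restr !inE.
case: ifPn => hi; case: ifPn => // iA.
  have := none (x0, i); rewrite /= x0A iA/= ltn_neqAle hi andbT => /negbFE/eqP e.
  by move: iA; rewrite -(val_inj e) x0A.
by rewrite x0m in hi.
Qed.

End Box.

(** * Sums of weighted independent Bernoulli variables *)

Section Bernoulli.
Context {R : realType} {n : nat}.
Implicit Types (pi w : 'I_n -> R) (phi psi : {set 'I_n} -> R) (A : {set 'I_n}).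

(** The set [A] encodes the outcome in which exactly the variables indexed by [A] equal [1]. *)
Definition bern pi A : R := \prod_i (if i \in A then pi i else 1 - pi i).

Definition bernE pi phi : R := \sum_A bern pi A * phi A.

Definition unit_valued pi := forall i, 0 <= pi i <= 1.

Lemma bern_ge0 pi A : unit_valued pi -> 0 <= bern pi A.
Proof.
move=> pi01; apply: prodr_ge0 => i _; have /andP[? ?] := pi01 i.
by case: ifP => _; rewrite // subr_ge0.
Qed.

Lemma bernE_cst pi (c : R) : bernE pi (fun=> c) = c.
Proof.
rewrite /bernE -mulr_suml -bigA_distr.
by rewrite big1 ?mul1r// => i _ /=; rewrite addrC subrK.
Qed.

Lemma bernED pi phi psi :
  bernE pi (fun A => phi A + psi A) = bernE pi phi + bernE pi psi.
Proof. by rewrite -big_split; apply: eq_bigr => A _; rewrite mulrDr. Qed.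

Lemma bernEZ pi c phi : bernE pi (fun A => c * phi A) = c * bernE pi phi.
Proof. by rewrite /bernE mulr_sumr; apply: eq_bigr => A _; rewrite mulrCA. Qed.

Lemma eq_bernE pi phi psi : phi =1 psi -> bernE pi phi = bernE pi psi.
Proof. by move=> e; apply: eq_bigr => A _; rewrite e. Qed.

Lemma bernE_le pi phi psi : unit_valued pi -> (forall A, phi A <= psi A) ->
  bernE pi phi <= bernE pi psi.
Proof. by move=> pi01 le; apply: ler_sum => A _; rewrite ler_wpM2l// bern_ge0. Qed.

Lemma bern_upd0 pi i A : bern (upd pi i 0) A =
  if i \in A then 0 else \prod_(j | j != i) (if j \in A then pi j else 1 - pi j).
Proof.
rewrite /bern (bigD1 i)//= /upd eqxx subr0; case: ifP => _; first by rewrite mul0r.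
by rewrite mul1r; apply: eq_bigr => j /negbTE ->.
Qed.

(** By independence, replacing [pi i] by [0] amounts to conditioning on variable [i] being zero. *)
Lemma bernE_notin pi i phi :
  bernE pi (fun A => (i \notin A)%:R * phi A) = (1 - pi i) * bernE (upd pi i 0) phi.
Proof.
rewrite /bernE mulr_sumr; apply: eq_bigr => A _; rewrite bern_upd0.
case: ifPn => iA; first by rewrite !(mul0r, mulr0).
by rewrite mul1r mulrA; congr (_ * _); rewrite /bern (bigD1 i)//= (negbTE iA).
Qed.

Lemma bernE_in pi i phi :
  bernE pi (fun A => (i \in A)%:R * phi A) =
  pi i * bernE (upd pi i 0) (fun A => phi (i |: A)).
Proof.
rewrite /bernE mulr_sumr (bigID [pred A : {set 'I_n} | i \in A])/=.
rewrite [X in _ + X]big1 ?addr0 => [|A /negbTE ->]; last by rewrite mul0r mulr0.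
rewrite (reindex_onto (fun A => i |: A) (fun A => A :\ i)) ; last first.
  by move=> A iA; exact: finset.setD1K.
rewrite [RHS](bigID [pred A : {set 'I_n} | i \notin A])/= [X in _ = _ + X]big1.
  rewrite addr0; apply: eq_big => [A|A].
    rewrite finset.setU11/=; apply/eqP/idP => [<-|iA]; first by rewrite !inE eqxx.
    by rewrite finset.setU1K.
  move=> /andP[_ /eqP iA]; have {}iA : i \notin A by rewrite -iA !inE eqxx.
  rewrite finset.setU11 mul1r bern_upd0 (negbTE iA) mulrA; congr (_ * _).
  rewrite /bern (bigD1 i)//= finset.setU11; congr (_ * _).
  by apply: eq_bigr => j ji; rewrite in_setU1 (negbTE ji).
by move=> A /negPn iA; rewrite bern_upd0 iA mul0r mulr0.
Qed.

Lemma bernE_split pi i phi : bernE pi phi =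
  pi i * bernE (upd pi i 0) (fun A => phi (i |: A)) +
  (1 - pi i) * bernE (upd pi i 0) phi.
Proof.
rewrite -bernE_in -bernE_notin -bernED; apply: eq_bernE => A.
by case: (i \in A); rewrite /= mul0r mul1r (add0r, addr0).
Qed.

Definition wt w A : R := \sum_(i in A) w i.

Lemma bernE_wt pi w phi : bernE pi (fun A => wt w A * phi A) =
  \sum_i w i * bernE pi (fun A => (i \in A)%:R * phi A).
Proof.
under eq_bigr => i _ do rewrite -bernEZ.
rewrite /bernE exchange_big/=; apply: eq_bigr => A _.
rewrite -mulr_sumr /wt mulr_suml big_mkcond; congr (_ * _).
by apply: eq_bigr => i _; case: (i \in A); rewrite ?mul1r// mul0r mulr0.
Qed.

Lemma bernE_wt_mean pi w : bernE pi (wt w) = \sum_i w i * pi i.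
Proof.
transitivity (bernE pi (fun A => wt w A * 1)).
  by apply: eq_bernE => A; rewrite mulr1.
rewrite bernE_wt; apply: eq_bigr => i _.
by rewrite bernE_in bernE_cst mulr1.
Qed.

Variables (w : 'I_n -> R) (lambda : R).
Hypothesis w0 : forall i, 0 <= w i.

(** The expectations of [below] and [slack] are [f = P(S < lambda)] and [e = E (lambda - S)_+]. *)
Definition below A : R := (wt w A < lambda)%R%:R.
Definition slack A : R := (lambda - wt w A) * below A.

Lemma below_ge0 A : 0 <= below A.
Proof. exact: ler0n. Qed.

Lemma slack_ge A : lambda - wt w A <= slack A.
Proof.
rewrite /slack /below; case: ltP => h; first by rewrite mulr1.
by rewrite mulr0 subr_le0.
Qed.

Lemma bernE_slack_ge pi : unit_valued pi ->
  lambda - \sum_i w i * pi i <= bernE pi slack.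
Proof.
move=> pi01; apply: le_trans (@bernE_le pi _ slack pi01 slack_ge).
rewrite (bernED pi (fun=> lambda) (fun A => - wt w A)) bernE_cst lerD2l.
rewrite -bernE_wt_mean -mulN1r -bernEZ le_eqVlt; apply/orP; left; apply/eqP.
by apply: eq_bernE => A; rewrite mulN1r.
Qed.

Lemma bernE_slack_le pi : unit_valued pi ->
  bernE pi slack <= lambda * bernE pi below.
Proof.
move=> pi01; rewrite -bernEZ; apply: bernE_le => // A.
by rewrite ler_wpM2r ?below_ge0// gerBl sumr_ge0.
Qed.

(* A form of Wald's identity: stop before revealing variable [i] if the others
   already reach [lambda]. *)
Lemma bernE_slack_upd pi i : unit_valued pi ->
  bernE (upd pi i 0) slack - w i * pi i * bernE (upd pi i 0) below <=
  bernE pi slack.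
Proof.
move=> pi01; have /andP[pi0 pi1] := pi01 i.
have pi'01 : unit_valued (upd pi i 0).
  by move=> j; rewrite /upd; case: eqP => // _; rewrite lexx ler01.
rewrite [leRHS](bernE_split pi i) addrC.
rewrite -subr_ge0 (_ : _ - _ = pi i * (bernE (upd pi i 0) (fun A => slack (i |: A))
  + w i * bernE (upd pi i 0) below - bernE (upd pi i 0) slack)); last by ring.
rewrite mulr_ge0// subr_ge0 -bernEZ -bernED; apply: ler_sum => A _.
rewrite bern_upd0; case: ifPn => iA; first by rewrite !mul0r.
rewrite ler_wpM2l ?prodr_ge0// => [j _|].
  by have /andP[? ?] := pi01 j; case: ifP => _; rewrite // subr_ge0.
rewrite /slack /below.
have -> : wt w (i |: A) = w i + wt w A by rewrite /wt big_setU1.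
(* Outcome by outcome, adding [w i] lowers the slack by at most [w i], and only when the other
   variables stay below [lambda]. *)
have := w0 i; case: (ltP (wt w A) lambda);
  case: (ltP (w i + wt w A) lambda) => /=; lra.
Qed.

(* Under the law conditioned on [wt w A < lambda], the covariances of [wt w A]
   with the indicators of [i \in A], weighted by [w i], add up to a variance,
   so one of them is nonnegative. *)
Lemma bernE_exists_upd pi : (forall i, 0 <= pi i < 1) ->
  0 < bernE pi below -> (exists i, 0 < w i * pi i) ->
  exists i, 0 < w i * pi i /\
    bernE (upd pi i 0) below * bernE pi slack <=
    bernE pi below * bernE (upd pi i 0) slack.
Proof.
move=> pi01 f0 [i0 m0]; apply: contrapT => /forallNP none.
have {}pi01' : unit_valued pi by move=> i; have /andP[-> /ltW] := pi01 i.
set f := bernE pi below in f0 none *; set e := bernE pi slack in none *.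
pose fi i := bernE pi (fun A => (i \in A)%:R * below A).
pose ei i := bernE pi (fun A => (i \in A)%:R * slack A).
have outE i phi : bernE pi (fun A => (i \in A)%:R * phi A) =
    bernE pi phi - (1 - pi i) * bernE (upd pi i 0) phi.
  by rewrite bernE_in [bernE pi phi](bernE_split pi i) addrK.
(* Failure of the claim at [i] says that, given [S < lambda], the indicator of [i] has positive
   covariance with [lambda - S]. *)
have lt i : 0 < w i * pi i -> fi i * e < f * ei i.
  move=> mi; have /not_andP[//|/negP] := none i; rewrite -ltNge => lt.
  have /andP[_ pi1] := pi01 i; rewrite /fi /ei !outE -/f -/e.
  rewrite mulrBl mulrBr -ltrBDl addrAC subrr add0r ltrN2 mulrCA -mulrA.
  by rewrite ltr_pM2l ?subr_gt0.
have le i : w i * (fi i * e) <= w i * (f * ei i).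
  have [/lt /ltW h|mi] := ltP 0 (w i * pi i); first by rewrite ler_wpM2l.
  have /andP[p0 _] := pi01 i.
  have : w i * pi i == 0 by rewrite eq_le mi mulr_ge0.
  rewrite mulf_eq0 => /orP[/eqP ->|/eqP p]; first by rewrite !mul0r.
  by rewrite /fi /ei !bernE_in p !(mul0r, mulr0).
have sums : \sum_i w i * (fi i * e) < \sum_i w i * (f * ei i).
  rewrite (bigD1 i0)//= [ltRHS](bigD1 i0)//= ltr_leD ?ler_sum// ltr_pM2l ?lt//.
  by rewrite lt_neqAle w0 andbT; apply: contraTneq m0 => <-; rewrite mul0r ltxx.
pose e2 := bernE pi (fun A => (lambda - wt w A) * slack A).
have sumf : \sum_i w i * fi i = lambda * f - e.
  rewrite -bernE_wt /f /e -bernEZ; apply/eqP; rewrite eq_sym subr_eq -bernED.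
  by apply/eqP/eq_bernE => A; rewrite /slack; ring.
have sume : \sum_i w i * ei i = lambda * e - e2.
  rewrite -bernE_wt /e /e2 -bernEZ; apply/eqP; rewrite eq_sym subr_eq -bernED.
  by apply/eqP/eq_bernE => A; rewrite /slack; ring.
have {sums} lt2 : f * e2 < e * e.
  have -> : f * e2 = f * (lambda * e) - f * \sum_i w i * ei i by rewrite sume; ring.
  have -> : e * e = f * (lambda * e) - (\sum_i w i * fi i) * e by rewrite sumf; ring.
  rewrite ltrD2l ltrN2 mulr_suml mulr_sumr.
  under eq_bigr do rewrite -mulrA.
  by under [ltRHS]eq_bigr do rewrite mulrCA.
(* Up to a positive factor, this is the variance of [lambda - S] given [S < lambda], which [lt2]
   would make negative. *)
have : 0 <= bernE pi (fun A => (f * (lambda - wt w A) - e) ^+ 2 * below A).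
  apply: sumr_ge0 => A _; rewrite mulr_ge0 ?bern_ge0// mulr_ge0 ?sqr_ge0//.
have -> : bernE pi (fun A => (f * (lambda - wt w A) - e) ^+ 2 * below A) =
    f * (f * e2 - e * e).
  transitivity (bernE pi (fun A => f ^+ 2 * ((lambda - wt w A) * slack A) +
      (- (2 * f * e) * slack A + e ^+ 2 * below A))).
    by apply: eq_bernE => A; rewrite /slack; ring.
  by rewrite !bernED !bernEZ -/e2 -/e -/f; ring.
by rewrite pmulr_rge0// subr_ge0 leNgt lt2.
Qed.

(** Induction on the number of variables with positive mean, [beta] staying fixed. The hypothesis is
    the inequality [f <= beta * e] because a removal may lower the ratio [f / e]. *)
Lemma bernE_slack_bound pi beta : (forall i, 0 <= pi i < 1) ->
  \sum_i w i * pi i < lambda -> bernE pi below <= beta * bernE pi slack ->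
  beta * (lambda - \sum_i w i * pi i) <= 1 ->
  exists m : 'I_n -> R, [/\ forall i, 0 <= m i <= w i * pi i,
    beta * (lambda - \sum_i w i * pi i + \sum_i m i) = 1 &
    \prod_i (1 - beta * m i) <= beta * bernE pi slack].
Proof.
have [k] := ubnP #|[set i | w i * pi i > 0]|.
elim: k pi => // k IH pi; rewrite ltnS => mk pi01 Mlt fe bM.
have pi01' : unit_valued pi by move=> i; have /andP[-> /ltW] := pi01 i.
have m0 i : 0 <= w i * pi i by have /andP[? _] := pi01 i; rewrite mulr_ge0.
have l0 : 0 < lambda by apply: le_lt_trans Mlt; rewrite sumr_ge0.
have M0 : 0 < lambda - \sum_i w i * pi i by rewrite subr_gt0.
have e0 := lt_le_trans M0 (bernE_slack_ge _ pi01').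
have f0 : 0 < bernE pi below.
  by rewrite -(pmulr_rgt0 _ l0) (lt_le_trans e0)// bernE_slack_le.
have b0 : 0 < beta by rewrite -(pmulr_lgt0 _ e0) (lt_le_trans f0).
have bl : 1 <= beta * lambda.
  rewrite -(ler_pM2r e0) mul1r (le_trans (bernE_slack_le _ pi01'))//.
  by rewrite mulrAC mulrC ler_wpM2r// ltW.
have [[i mi]|none] := pselect (exists i, 0 < w i * pi i); last first.
  have mE i : w i * pi i = 0.
    apply/eqP; rewrite eq_le m0 andbT leNgt; apply/negP => mi; apply: none.
    by exists i.
  have ME : \sum_i w i * pi i = 0 by rewrite big1.
  (* With no mean left, the two bounds on [beta * lambda] meet, so nothing more is to be removed. *)
  have {bM}bE : beta * lambda = 1.
    by apply/eqP; rewrite eq_le bl andbT; rewrite ME subr0 in bM.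
  exists (fun=> 0); split => [i||].
  - by rewrite m0 lexx.
  - by rewrite ME big1// subr0 addr0.
  - rewrite big1 => [|i _]; last by rewrite mulr0 subr0.
    rewrite -bE ler_wpM2l ?(ltW b0)//.
    by have := bernE_slack_ge _ pi01'; rewrite ME subr0.
have [|j [mj cov]] := @bernE_exists_upd pi pi01 f0; first by exists i.
set pi' := upd pi j 0 in cov.
have sum' : \sum_i w i * pi' i = \sum_i w i * pi i - w j * pi j.
  rewrite [in RHS](bigD1 j)//= addrAC subrr add0r (bigD1 j)//= /pi' /upd eqxx.
  by rewrite mulr0 add0r; apply: eq_bigr => l /negbTE ->.
have pi'01 l : 0 <= pi' l < 1.
  by rewrite /pi' /upd; case: eqP => // _; rewrite lexx ltr01.
have pi'01' : unit_valued pi' by move=> l; have /andP[-> /ltW] := pi'01 l.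
have M'lt : \sum_i w i * pi' i < lambda.
  by rewrite sum' (le_lt_trans _ Mlt)// gerBl.
have e'0 : 0 < bernE pi' slack.
  by apply: lt_le_trans (bernE_slack_ge _ pi'01'); rewrite subr_gt0.
(* Writing [f'] and [e'] for the values after removal of [j]: [f' * e <= f * e' <= beta * e * e'],
   and [e] cancels. *)
have fe' : bernE pi' below <= beta * bernE pi' slack.
  rewrite -(ler_pM2r e0) (le_trans cov)// mulrAC [leRHS]mulrAC.
  rewrite (_ : _ * _ * _ = beta * bernE pi slack * bernE pi' slack); last by ring.
  by rewrite ler_wpM2r// ltW.
have [bM'|bM'] := leP (beta * (lambda - \sum_i w i * pi' i)) 1; last first.
  (* With [d = lambda - \sum_i w i * pi i], removing all of [j] would overshoot [beta^-1]. The part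
     [x] solves [beta * (d + x) = 1], and the only nontrivial factor [1 - beta * x = beta * d] is at
     most [beta * e]. *)
  pose x := beta^-1 - (lambda - \sum_i w i * pi i).
  have x0 : 0 <= x.
    by rewrite subr_ge0 -[beta^-1]mul1r ler_pdivlMr// mulrC.
  exists (upd (fun=> 0) j x); split.
  - move=> l; rewrite /upd; case: eqP => [->|_]; last by rewrite lexx m0.
    rewrite x0/= /x lerBlDr -[beta^-1]mul1r ler_pdivrMr// mulrC ltW//.
    by move: bM'; rewrite sum' opprB addrCA addrA.
  - rewrite sum_upd [X in x + X]big1// addr0 /x addrC subrK divff// gt_eqF//.
  - rewrite (bigD1 j)//= big1 => [|l /negbTE lj]; last first.
      by rewrite /upd lj mulr0 subr0.
    rewrite /upd eqxx mulr1 /x mulrBr divff ?gt_eqF// subKr.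
    by rewrite ler_wpM2l ?(ltW b0)// bernE_slack_ge.
have [|m [mb mE mle]] := IH pi' _ pi'01 M'lt fe' bM'.
  apply: leq_trans mk; apply: proper_card; apply/properP; split.
    apply/fintype.subsetP => l; rewrite !inE /pi' /upd; case: eqP => // _.
    by rewrite mulr0 ltxx.
  by exists j; rewrite !inE ?mj// /pi' /upd eqxx mulr0 ltxx.
(* Variable [j] has mean [0] under [pi'], so its slot in [m] is free for the mean just removed. *)
have mj0 : m j = 0.
  apply/eqP; rewrite eq_le; have /andP[-> h] := mb j; rewrite andbT.
  by rewrite (le_trans h)// /pi' /upd eqxx mulr0.
have restE : \sum_(l | l != j) m l = \sum_l m l.
  by rewrite [RHS](bigD1 j)//= mj0 add0r.
have sumE : lambda - \sum_i w i * pi i + \sum_i upd m j (w j * pi j) i =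
    lambda - \sum_i w i * pi' i + \sum_i m i.
  by rewrite sum_upd restE sum'; ring.
exists (upd m j (w j * pi j)); split => [l||].
- rewrite /upd; case: eqP => [->|lj]; first by rewrite m0 lexx.
  by have := mb l; rewrite /pi' /upd; case: eqP.
- by rewrite sumE.
- have bmj : 0 <= 1 - beta * (w j * pi j).
    rewrite subr_ge0 -mE sum' ler_wpM2l ?(ltW b0)// opprB addrCA -addrA lerDl.
    rewrite addr_ge0 ?(ltW M0)// sumr_ge0// => l _; by have /andP[] := mb l.
  apply: (@le_trans _ _ ((1 - beta * (w j * pi j)) * (beta * bernE pi' slack))).
    rewrite (bigD1 j)//= {1}/upd eqxx ler_wpM2l//.
    rewrite (le_trans _ mle)// [leRHS](bigD1 j)//= mj0 mulr0 subr0 mul1r.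
    rewrite le_eqVlt; apply/orP; left; apply/eqP.
    by apply: eq_bigr => l /negbTE lj; rewrite /upd lj.
  (* The Wald bound and [f' <= beta * e'] give [e >= e' - w j * pi j * f' >= (1 - beta * (w j * pi
     j)) * e']. *)
  rewrite mulrCA ler_wpM2l ?(ltW b0)// (le_trans _ (bernE_slack_upd _ j pi01'))//.
  rewrite -/pi' mulrBl mul1r lerD2l lerN2 [beta * _]mulrC -[leRHS]mulrA.
  by rewrite ler_wpM2l// ltW.
Qed.

Lemma bernE_below_ge pi : (forall i, 0 <= pi i < 1) ->
  \sum_i w i * pi i < lambda ->
  exists2 m : 'I_n -> R, forall i, 0 <= m i <= w i * pi i &
    null_prob (lambda - \sum_i w i * pi i) m <= bernE pi below.
Proof.
move=> pi01 Mlt.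
have pi01' : unit_valued pi by move=> i; have /andP[-> /ltW] := pi01 i.
have m0 i : 0 <= w i * pi i by have /andP[? _] := pi01 i; rewrite mulr_ge0.
have M0 : 0 < lambda - \sum_i w i * pi i by rewrite subr_gt0.
have e0 := lt_le_trans M0 (bernE_slack_ge _ pi01').
pose beta := bernE pi below / bernE pi slack.
have bE : beta * bernE pi slack = bernE pi below by rewrite divfK// gt_eqF.
have b0 : 0 <= beta.
  rewrite divr_ge0 ?(ltW e0)//; apply: sumr_ge0 => A _.
  by rewrite mulr_ge0 ?bern_ge0 ?below_ge0.
have [bM|bM] := leP (beta * (lambda - \sum_i w i * pi i)) 1.
  have [|m [mb mE mle]] := bernE_slack_bound _ beta pi01 Mlt _ bM.
    by rewrite bE.
  exists m => //; rewrite -bE (le_trans _ mle)// /null_prob.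
  set L := _ + _ in mE *; have -> : beta = L^-1.
    have L0 : L != 0 by apply: contra_eq_neq mE => ->; rewrite mulr0 eq_sym oner_eq0.
    by rewrite -[LHS]mulr1 -(divff L0) mulrA mE mul1r.
  rewrite le_eqVlt; apply/orP; left; apply/eqP.
  by apply: eq_bigr => i _; rewrite mulrC.
(* If [beta * d > 1], then [f = beta * e >= beta * d] exceeds [1], the null probability of the zero
   vector. *)
exists (fun=> 0) => [i|]; first by rewrite lexx m0.
rewrite /null_prob big1 => [|i _]; last by rewrite mul0r subr0.
by rewrite -bE (le_trans (ltW bM))// ler_wpM2l// bernE_slack_ge.
Qed.

End Bernoulli.

(** * Finite laws as mixtures of two-point laws with the same mean *)

Section TwoPoint.
Context {R : realType} {V : finType}.
Implicit Types (x rho : V -> R) (nu : R) (t : V * V).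

(* When [x t.1 = nu = x t.2] the quotient is [0 / 0 = 0]. *)
Definition high_weight x nu t : R := (nu - x t.1) / (x t.2 - x t.1).

Definition two_point x nu t v : R :=
  (1 - high_weight x nu t) * (v == t.1)%:R + high_weight x nu t * (v == t.2)%:R.

(** The second alternative is the point mass at the mean; the strict inequality in the first keeps
    the weight of the high value below [1]. *)
Definition straddles x nu t : bool :=
  (x t.1 <= nu < x t.2) || ((t.1 == t.2) && (x t.1 == nu)).

Lemma sum_two_point x nu t : \sum_v two_point x nu t v = 1.
Proof.
rewrite big_split/= -!mulr_sumr.
have d1 (a : V) : \sum_v (v == a)%:R = 1 :> R.
  by rewrite (bigD1 a)//= eqxx big1 ?addr0// => v /negbTE ->.
by rewrite !d1 !mulr1 subrK.
Qed.

(** The total deviations below and above the mean agree; call them [c]. Pairing each low [a] with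
    each high [b] with weight [rho a * rho b * (x b - x a) / c] then gives back [rho]. *)
Lemma two_point_mixture x rho : (forall v, 0 <= rho v) -> \sum_v rho v = 1 ->
  exists W : V * V -> R,
  [/\ forall t, 0 <= W t, \sum_t W t = 1,
    forall t, W t != 0 -> straddles x (\sum_v rho v * x v) t &
    forall v, rho v = \sum_t W t * two_point x (\sum_v rho v * x v) t v].
Proof.
move=> rho0 rho1; set nu := \sum_v rho v * x v.
have sumW W : (forall v, rho v = \sum_t W t * two_point x nu t v) -> \sum_t W t = 1.
  move=> WE; rewrite -rho1; under [RHS]eq_bigr do rewrite WE.
  rewrite exchange_big/=; apply: eq_bigr => t _.
  by rewrite -mulr_sumr sum_two_point mulr1.
pose c := \sum_(v | nu < x v) rho v * (x v - nu).
have cE : \sum_(v | x v <= nu) rho v * (nu - x v) = c.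
  have : \sum_v rho v * (x v - nu) = 0.
    under eq_bigr do rewrite mulrBr.
    by rewrite sumrB -mulr_suml rho1 mul1r subrr.
  rewrite (bigID [pred v | nu < x v])/= -/c => /eqP.
  rewrite addrC addr_eq0 => /eqP h.
  rewrite -[RHS]opprK -h -sumrN; apply: eq_big => [v|v _]; first by rewrite leNgt.
  by rewrite -mulrN opprB.
have hi v : nu < x v -> 0 <= rho v * (x v - nu).
  by move=> h; rewrite mulr_ge0// subr_ge0 ltW.
have lo v : x v <= nu -> 0 <= rho v * (nu - x v).
  by move=> h; rewrite mulr_ge0// subr_ge0.
(* If [c = 0], the law sits at its mean and point masses suffice. *)
have [c0|cN0] := eqVneq c 0.
  have conc v : rho v != 0 -> x v = nu.
    move=> rv; have [h|h] := leP (x v) nu.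
      move/eqP: cE; rewrite c0 psumr_eq0// => /allP/(_ v (mem_index_enum _)).
      by rewrite h mulf_eq0 (negbTE rv) subr_eq0 => /eqP.
    move/eqP: c0; rewrite /c psumr_eq0// => /allP/(_ v (mem_index_enum _)).
    by rewrite h mulf_eq0 (negbTE rv) subr_eq0 => /eqP.
  pose W t := rho t.1 * (t.1 == t.2)%:R.
  have WE v : rho v = \sum_t W t * two_point x nu t v.
    rewrite (bigD1 (v, v))//= [X in _ + X]big1 => [|[a b] /= ab].
      by rewrite /W /two_point /= eqxx !mulr1 subrK mulr1 addr0.
    rewrite /W /two_point /=.
    case: (a =P b) ab => [<-|_]; last by rewrite mulr0 mul0r.
    rewrite xpair_eqE andbb [v == a]eq_sym => /negbTE ->.
    by rewrite !mulr0 addr0 mulr0.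
  exists W; split=> // [t||t].
  - by rewrite mulr_ge0.
  - exact: sumW.
  - rewrite /W mulf_eq0 negb_or pnatr_eq0 eqb0 negbK => /andP[/conc e ab].
    by rewrite /straddles ab e eqxx orbT.
have c_gt0 : 0 < c by rewrite lt_neqAle eq_sym cN0 sumr_ge0.
pose L a : R := (x a <= nu)%R%:R; pose H b : R := (nu < x b)%R%:R.
pose W t := L t.1 * H t.2 * (rho t.1 * rho t.2 * (x t.2 - x t.1) / c).
have sumL : \sum_a L a * (rho a * (nu - x a)) = c.
  by rewrite -cE [RHS]big_mkcond; apply: eq_bigr => a _; rewrite -mulrb mulr_natl.
have sumH : \sum_b H b * (rho b * (x b - nu)) = c.
  by rewrite [RHS]big_mkcond; apply: eq_bigr => b _; rewrite -mulrb mulr_natl.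
have pick (F : V -> R) v : \sum_a (v == a)%:R * F a = F v.
  rewrite (bigD1 v)//= eqxx mul1r big1 ?addr0// => a.
  by rewrite eq_sym => /negbTE ->; rewrite mul0r.
have WE v : rho v = \sum_t W t * two_point x nu t v.
  transitivity (L v * rho v / c * c + c * (H v * rho v / c)).
    rewrite mulrC -mulrDr -mulrDl -mulrDl [c * _]mulrC divfK//.
    by rewrite /L /H; case: leP => _; rewrite ?addr0 ?add0r mul1r.
  (* Each [c] is expanded as a sum over the opposite side, which turns both halves of [rho v] into
     sums over pairs. *)
  rewrite -[X in _ * X + _]sumH -[X in _ + X * _]sumL.
  rewrite -(pick (fun a => L a * rho a / c)) -(pick (fun b => H b * rho b / c)).
  rewrite !big_distrlr -big_split/=.
  rewrite -(pair_bigA _ (fun a b => W (a, b) * two_point x nu (a, b) v))/=.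
  apply: eq_bigr => a _; rewrite -big_split; apply: eq_bigr => b _.
  rewrite /W /two_point /high_weight /L /H /=.
  case: (leP (x a)) => ha; case: (ltP nu) => hb;
    rewrite ?(mul0r, mulr0, add0r, addr0)//.
  by field; rewrite cN0/= subr_eq0 gt_eqF// (le_lt_trans ha hb).
exists W; split=> // [t||t].
- rewrite /W /L /H; case: (leP (x t.1)) => h1; last by rewrite !mul0r.
  case: (ltP nu) => h2; last by rewrite mulr0 mul0r.
  rewrite !mul1r divr_ge0 ?(ltW c_gt0)// mulr_ge0 ?mulr_ge0// subr_ge0.
  by rewrite (le_trans h1) ?ltW.
- exact: sumW.
- rewrite /W /L /H /straddles; case: (leP (x t.1)) => _; last by rewrite !mul0r eqxx.
  by case: (ltP nu) => _ //; rewrite mulr0 mul0r eqxx.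
Qed.

End TwoPoint.

(** * The lower bound for independent finite laws *)

Section FiniteLaws.
Context {R : realType} {V : finType} {n : nat}.
Implicit Types (x : V -> R) (rho : 'I_n -> V -> R).

(** Expanding the product gives one term per set [A] of coordinates at their high value; the sum
    over [f] keeps only the function determined by [A]. *)
Lemma sum_two_point_product (pi : 'I_n -> R) (t : 'I_n -> V * V)
    (phi : {ffun 'I_n -> V} -> R) :
  \sum_(f : {ffun 'I_n -> V}) phi f *
    \prod_i ((1 - pi i) * (f i == (t i).1)%:R + pi i * (f i == (t i).2)%:R) =
  bernE pi (fun A => phi [ffun i => if i \in A then (t i).2 else (t i).1]).
Proof.
under eq_bigr => f _ do
  (under eq_bigr => i _ do rewrite addrC; rewrite bigA_distr/= mulr_sumr).
rewrite exchange_big/=; apply: eq_bigr => A _.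
set g := [ffun i => _]; rewrite (bigD1 g)//= [X in _ + X]big1 ?addr0 => [|f fg].
  rewrite mulrC /bern; congr (_ * _); apply: eq_bigr => i _.
  by rewrite /g ffunE; case: (i \in A); rewrite eqxx mulr1.
have [i fgi] : exists i, f i != g i.
  apply/existsP; rewrite -negb_forall; apply: contra fg => /forallP h.
  by apply/eqP/ffunP => i; apply/eqP.
rewrite (bigD1 i)//= (_ : (if _ then _ else _) = 0) ?mul0r ?mulr0//.
by move: fgi; rewrite /g ffunE; case: (i \in A) => /negbTE ->; rewrite mulr0.
Qed.

(** A product of mixtures is a mixture of products of two-point laws. The probability is thus an
    average over the choices [th], and some [th] of nonzero weight has a value no larger. *)
Lemma finite_laws_ge x rho (lambda : R)
    (nu := fun i => \sum_v rho i v * x v) :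
  (forall v, 0 <= x v) -> (forall i v, 0 <= rho i v) ->
  (forall i, \sum_v rho i v = 1) -> \sum_i nu i < lambda ->
  exists2 m : 'I_n -> R, forall i, 0 <= m i <= nu i &
    null_prob (lambda - \sum_i nu i) m <=
    \sum_(f : {ffun 'I_n -> V} | \sum_i x (f i) < lambda)
      \prod_i rho i (f i).
Proof.
move=> x0 rho0 rho1 nulam.
have [W WP] := choice (fun i => two_point_mixture x (rho i) (rho0 i) (rho1 i)).
have W0 i t : 0 <= W i t by have [h _ _ _] := WP i; apply: h.
have W1 i : \sum_t W i t = 1 by have [_ h _ _] := WP i; apply: h.
pose phi (f : {ffun 'I_n -> V}) : R := (\sum_i x (f i) < lambda)%R%:R.
pose val (th : {ffun 'I_n -> V * V}) : R :=
  \sum_(f : {ffun 'I_n -> V}) phi f * \prod_i two_point x (nu i) (th i) (f i).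
set P := \sum_(f : {ffun 'I_n -> V} | _) _.
have mixE : P =
    \sum_(th : {ffun 'I_n -> V * V}) (\prod_i W i (th i)) * val th.
  rewrite /P big_mkcond/=; under eq_bigr => f _.
    rewrite (_ : (if _ then _ else _) = phi f * \prod_i rho i (f i)); last first.
      by rewrite /phi; case: ifP; rewrite ?mul1r ?mul0r.
    under eq_bigr => i _ do (have [_ _ _ ->] := WP i).
    rewrite bigA_distr_bigA mulr_sumr.
    over.
  rewrite exchange_big; apply: eq_bigr => th _.
  by rewrite mulr_sumr; apply: eq_bigr => f _; rewrite big_split mulrCA.
have sumW1 : \sum_(th : {ffun 'I_n -> V * V}) \prod_i W i (th i) = 1.
  by rewrite -bigA_distr_bigA big1.
have [th [Wth le]] : exists th : {ffun 'I_n -> V * V},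
    \prod_i W i (th i) != 0 /\ val th <= P.
  apply: contrapT => /forallNP none.
  have le0 (th : {ffun 'I_n -> V * V}) :
      0 <= (\prod_i W i (th i)) * (val th - P) :> R.
    have [->|N0] := eqVneq (\prod_i W i (th i)) 0; first by rewrite mul0r.
    have /not_andP[//|/negP] := none th; rewrite -ltNge => h.
    by rewrite mulr_ge0 ?prodr_ge0// subr_ge0 ltW.
  have : \sum_(th : {ffun 'I_n -> V * V}) (\prod_i W i (th i)) * (val th - P) == 0.
    under eq_bigr do rewrite mulrBr.
    by rewrite sumrB -mulr_suml sumW1 mul1r -mixE subrr.
  rewrite psumr_eq0// => /allP all0.
  have /eqP := oner_neq0 R; apply; rewrite -sumW1 big1// => th _; apply/eqP.
  apply: contraT => N0; have := all0 th (mem_index_enum _).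
  rewrite /= mulf_eq0 (negbTE N0)/=.
  have /not_andP[//|/negP] := none th; rewrite -ltNge => h.
  by rewrite subr_eq0 gt_eqF.
have strad i : straddles x (nu i) (th i).
  have [_ _ h _] := WP i; apply: h; apply: contraNneq Wth => Wi.
  by rewrite (bigD1 i)//= Wi mul0r.
pose pi i := high_weight x (nu i) (th i).
pose w i := x (th i).2 - x (th i).1.
have piw i : [/\ 0 <= pi i < 1, 0 <= w i & w i * pi i = nu i - x (th i).1].
  rewrite /pi /w /high_weight.
  case/orP: (strad i) => [/andP[h1 h2]|/andP[/eqP e /eqP <-]].
    have h : 0 < x (th i).2 - x (th i).1 by rewrite subr_gt0 (le_lt_trans h1).
    split; last by rewrite mulrC divfK// gt_eqF.
      by rewrite divr_ge0 ?(ltW h) ?subr_ge0//= ltr_pdivrMr// mul1r ltrD2r.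
    exact: ltW.
  by rewrite -e !subrr !mul0r lexx ltr01.
(* Subtracting the low values leaves multiples of Bernoulli variables, and the gap between threshold
   and total mean is unchanged. *)
pose lam' := lambda - \sum_i x (th i).1.
have meanE : lam' - \sum_i w i * pi i = lambda - \sum_i nu i.
  rewrite (eq_bigr (fun i => nu i - x (th i).1)) => [|i _]; last by have [] := piw i.
  by rewrite sumrB /lam' opprB addrA subrK.
have [||| m mb mle] := @bernE_below_ge R n w lam' _ pi.
- by move=> i; have [] := piw i.
- by move=> i; have [] := piw i.
- by rewrite -subr_gt0 meanE subr_gt0.
exists m.
  move=> i; have /andP[-> h] := mb i; rewrite (le_trans h)//.
  by have [_ _ ->] := piw i; rewrite gerBl.
rewrite -meanE (le_trans mle)// (le_trans _ le)//.
rewrite le_eqVlt; apply/orP; left; apply/eqP.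
rewrite /val /two_point sum_two_point_product; apply: eq_bernE => A.
rewrite /below /phi; congr (_%:R); congr nat_of_bool.
rewrite /lam' ltrBrDr /wt big_mkcond -big_split; congr (_ < _).
apply: eq_bigr => i _; rewrite ffunE /w.
by case: ifP => _; rewrite /= ?subrK// add0r.
Qed.

End FiniteLaws.

Local Open Scope classical_set_scope.
Local Open Scope ring_scope.

(** * Rounding to a finite grid on the half-line *)

Lemma measure_bigcup_fintype {R : realType} {d : measure_display}
    {T : measurableType d} (P : {measure set T -> \bar R}) {I : finType} (Q : pred I)
    (F : I -> set T) :
  (forall i, measurable (F i)) -> trivIset setT F ->
  (P (\bigcup_(i in [set i | Q i]) F i) = \sum_(i | Q i) P (F i))%E.
Proof.
move=> mF tF.
have QE : [set i | Q i] = [set` enum Q].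
  by apply/seteqP; split=> i; rewrite /= mem_enum.
rewrite QE measure_fin_bigcup//; first by rewrite -fsbig_seq ?enum_uniq// big_enum.
exact: sub_trivIset tF.
Qed.

Section Grid.
Context {R : realType} (h : R) (K : nat).
Hypothesis h0 : 0 < h.

(** The last cell [K] is unbounded, so the cells [0] to [K] partition the half-line. *)
Definition cell (k : nat) : set R :=
  [set r | k%:R * h <= r /\ ((k < K)%N -> r < k.+1%:R * h)].

Lemma measurable_cell k : measurable (cell k).
Proof.
have [kK|Kk] := ltnP k K.
- have -> : cell k = `[k%:R * h, k.+1%:R * h[%classic; last exact: measurable_itv.
  apply/seteqP; split=> r; rewrite /cell /= in_itv /= kK.
    by move=> [-> ->].
  by move=> /andP[].
- have -> : cell k = `[k%:R * h, +oo[%classic; last exact: measurable_itv.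
  apply/seteqP; split=> r; rewrite /cell /= in_itv /= andbT ltnNge Kk.
    by move=> [].
  by [].
Qed.

Lemma cell_exists r : 0 <= r -> exists k : 'I_K.+1, cell k r.
Proof.
move=> r0; have rh : 0 <= r / h by rewrite divr_ge0// ltW.
have kK : (minn K (Num.truncn (r / h)) < K.+1)%N by rewrite ltnS geq_minl.
have /andP[lo hi] := truncn_itv rh.
exists (Ordinal kK); split => /=.
  by rewrite -ler_pdivlMr// (le_trans _ lo)// ler_nat geq_minr.
rewrite gtn_min ltnn/= => tK; rewrite (minn_idPr (ltnW tK)).
by rewrite -ltr_pdivrMr.
Qed.

Lemma cell_inj r (k l : 'I_K.+1) : cell k r -> cell l r -> k = l.
Proof.
suff le (i j : 'I_K.+1) : cell i r -> cell j r -> (i <= j)%N.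
  by move=> ck cl; apply/val_inj/eqP; rewrite eqn_leq !le.
move=> [lo _] [_ hi]; rewrite leqNgt; apply/negP => ji.
have /hi : (j < K)%N by rewrite (leq_trans ji)// -ltnS.
by apply/negP; rewrite -leNgt (le_trans _ lo)// ler_wpM2r ?(ltW h0)// ler_nat.
Qed.

End Grid.

(** * Comparison of the variables with their rounded versions *)

Section Discretize.
Context {R : realType} {n : nat} {d : measure_display} {T : measurableType d}
  {P : probability T R}.
Variables (mu : 'I_n -> R) (X : 'I_n -> {RV P >-> R}).
Hypothesis HX : indep_nneg_with_means mu X.

Variables (h : R) (K : nat).
Hypothesis h0 : 0 < h.

Let V := 'I_K.+1.
Let x (k : V) : R := k%:R * h.
Let ev (i : 'I_n) (k : V) : set T := X i @^-1` cell h K k.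
Let rho (i : 'I_n) (k : V) : R := fine (P (ev i k)).

Lemma measurable_ev i k : measurable (ev i k).
Proof.
rewrite /ev -[X in measurable X]setTI.
by apply: measurable_funP => //; apply: measurable_cell.
Qed.

Lemma rhoE i k : (rho i k)%:E = P (ev i k).
Proof. by rewrite /rho fineK// fin_num_measure//; exact: measurable_ev. Qed.

Lemma trivIset_ev i : trivIset setT (ev i).
Proof. by move=> k l _ _ [w [/= ck cl]]; exact: (cell_inj _ _ h0 _ _ _ ck cl). Qed.

Lemma rho_sum1 i : \sum_k rho i k = 1.
Proof.
have [_ X0 _] := HX.
apply: EFin_inj; rewrite -sumEFin.
under eq_bigr do rewrite rhoE.
rewrite -(measure_bigcup_fintype P predT (ev i) (measurable_ev i) (trivIset_ev i)).
rewrite (_ : \bigcup_(_ in _) _ = setT); first exact: probability_setT.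
apply/seteqP; split=> // w _.
by have [k kw] := cell_exists _ K h0 _ (X0 i w); exists k.
Qed.

(** Every cell, the unbounded one included, is represented by its left endpoint, so rounding never
    raises a value. *)
Lemma rho_mean i : \sum_k rho i k * x k <= mu i.
Proof.
have [_ X0 EX] := HX.
have x0 k : 0 <= x k by rewrite mulr_ge0 ?ler0n// ltW.
rewrite -lee_fin -EX expectation_def -sumEFin.
rewrite (eq_bigr (fun k => \int[P]_w (x k * \1_(ev i k) w)%:E)%E); last first.
  move=> k _; rewrite EFinM rhoE muleC.
  rewrite (integralZl_indic _ (fun=> ev i k))//; last exact: measurable_ev.
    by rewrite integral_indic ?setIT//; exact: measurable_ev.
  by rewrite ltNge x0.
have m1 k : measurable_fun setT (fun w => (x k * \1_(ev i k) w)%:E).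
  apply/measurable_EFinP; apply: measurable_funM => //.
  by apply: measurable_indic; exact: measurable_ev.
rewrite -ge0_integral_sum//; last by move=> k w _; rewrite lee_fin mulr_ge0.
apply: ge0_le_integral => //.
- by move=> w _; apply: sume_ge0 => k _; rewrite lee_fin mulr_ge0.
- exact: emeasurable_sum.
- exact/measurable_EFinP.
move=> w _; rewrite sumEFin lee_fin.
have [k kw] := cell_exists _ K h0 _ (X0 i w).
rewrite (bigD1 k)//= big1 => [|l lk]; last first.
  rewrite indicE memNset ?mulr0// => lw.
  by move: lk; rewrite (cell_inj _ _ h0 _ _ _ lw kw) eqxx.
by rewrite indicE mem_set// mulr1 addr0; have [] := kw.
Qed.

Lemma prob_cells f : P [set w | forall i, ev i (f i) w] = (\prod_i rho i (f i))%:E.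
Proof.
have [ind _ _] := HX.
have := ind [set: 'I_n]%SET (fun i => cell h K (f i))
  (fun i => measurable_cell h K (f i)).
rewrite (_ : [set w | _] = [set w | forall i, ev i (f i) w]); last first.
  by apply/seteqP; split=> w /= hw i => [|_]; apply: hw; rewrite inE.
move=> ->; rewrite -prodEFin; apply: eq_big => [i|i _]; first by rewrite inE.
by rewrite rhoE.
Qed.

(** Rounding loses at most [h] per coordinate outside the last cell, and a rounded sum below
    [lambda' <= K%:R * h] excludes that cell. *)
Lemma prob_sum_ge (lambda lambda' : R) : lambda' <= K%:R * h ->
  lambda' + n%:R * h <= lambda ->
  ((\sum_(f : {ffun 'I_n -> V} | \sum_i x (f i) < lambda') \prod_i rho i (f i))%:E
   <= prob_sum_lt lambda X)%E.
Proof.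
move=> Kh lam; pose E (f : {ffun 'I_n -> V}) := [set w | forall i, ev i (f i) w].
have mE f : measurable (E f).
  rewrite (_ : E f = \bigcap_(i in setT) ev i (f i)).
    by apply: fin_bigcap_measurable => // i _; exact: measurable_ev.
  by apply/seteqP; split=> w hw i => [_|]; apply: hw.
have tE : trivIset setT E.
  move=> f g _ _ [w [/= fw gw]]; apply/ffunP => i.
  exact: (cell_inj _ _ h0 _ _ _ (fw i) (gw i)).
rewrite -sumEFin; under eq_bigr do rewrite -prob_cells.
rewrite -(measure_bigcup_fintype P _ E mE tE); apply: le_measure.
- by rewrite inE; apply: fin_bigcup_measurable => // f _; exact: mE.
- rewrite inE -[X in measurable X]setTI.
  rewrite (_ : [set w | _] = (fun w => \sum_(i < n) X i w) @^-1` `]-oo, lambda[).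
    apply: (measurable_sum _ (fun i => measurable_funP (X i))) => //.
  by apply/seteqP; split=> w; rewrite /= in_itv.
move=> w [f /= flt fw]; apply: lt_le_trans lam; rewrite mulr_natl.
have x0 k : 0 <= x k by rewrite mulr_ge0 ?ler0n// ltW.
have fK i : (f i < K)%N.
  rewrite ltn_neqAle -ltnS ltn_ord andbT; apply: contraTneq flt => fi.
  rewrite -leNgt (le_trans Kh)// (bigD1 i)//= {1}/x fi lerDl sumr_ge0//.
have [n0|n0] := posnP n.
  by move: flt w fw; subst n => flt w fw; rewrite !big_ord0 mulr0n addr0 in flt *.
rewrite (@le_lt_trans _ _ (\sum_i (x (f i) + h)))//; last first.
  by rewrite big_split/= sumr_const card_ord ltrD2r.
apply: ler_sum => i _; have [_ /(_ (fK i)) /ltW] := fw i.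
by rewrite /x -natr1 mulrDl mul1r.
Qed.

Lemma prob_sum_lt_null_prob (lambda lambda' : R) : lambda' <= K%:R * h ->
  lambda' + n%:R * h <= lambda -> \sum_i mu i < lambda' ->
  exists2 m : 'I_n -> R, forall i, 0 <= m i <= mu i &
    ((null_prob (lambda' - \sum_i mu i) m)%:E <= prob_sum_lt lambda X)%E.
Proof.
move=> Kh lam mulam.
have x0 k : 0 <= x k by rewrite mulr_ge0 ?ler0n// ltW.
have rho0 i k : 0 <= rho i k by rewrite fine_ge0.
have nule : \sum_i \sum_k rho i k * x k <= \sum_i mu i.
  by apply: ler_sum => i _; exact: rho_mean.
have [m mb le] :=
  finite_laws_ge x rho lambda' x0 rho0 rho_sum1 (le_lt_trans nule mulam).
exists m => [i|].
  by have /andP[-> /le_trans h1] := mb i; apply: h1; exact: rho_mean.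
apply: le_trans (prob_sum_ge _ _ Kh lam); rewrite lee_fin (le_trans _ le)//.
have m0 i : 0 <= m i by have /andP[] := mb i.
(* The rounded means are at most [mu], so [lambda' - \sum_i mu i] is the smaller gap, and each
   factor is nondecreasing in the gap. *)
apply: ler_prod => i _.
have d0 : 0 < lambda' - \sum_i mu i by rewrite subr_gt0.
have S0 : 0 <= \sum_j m j by rewrite sumr_ge0.
have mS : m i <= \sum_j m j by rewrite (bigD1 i)//= lerDl sumr_ge0.
have D0 : 0 < lambda' - \sum_i mu i + \sum_j m j by rewrite ltr_wpDr.
have dd : lambda' - \sum_i mu i + \sum_j m j <=
    lambda' - \sum_i \sum_k rho i k * x k + \sum_j m j.
  by rewrite lerD2r lerD2l lerN2.
apply/andP; split.
  by rewrite subr_ge0 ler_pdivrMr// mul1r (le_trans mS)// lerDr ltW.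
by rewrite lerD2l lerN2 ler_wpM2l// lef_pV2 ?posrE// (lt_le_trans D0).
Qed.

End Discretize.

(** * A probability space carrying independent two-valued variables *)

Section BernoulliSpace.
Context {R : realType} {n : nat}.
Variables (pi : 'I_n -> R) (pi01 : unit_valued pi).

(** Outcomes are coded in [nat], where every set is measurable; numbers that code no subset decode
    to the empty set and receive no mass. *)
Definition decode (j : nat) : {set 'I_n} :=
  if insub j is Some i then enum_val (i : 'I_#|{: {set 'I_n}}|) else finset.set0.

Definition bern_nng (j : nat) : {nonneg R} := NngNum (bern_ge0 pi (decode j) pi01).

Definition bern_measure : set nat -> \bar R :=
  msum (fun j => mscale (bern_nng j) (\d_j)) #|{: {set 'I_n}}|.

HB.instance Definition _ := Measure.on bern_measure.

Lemma sum_decode (F : {set 'I_n} -> R) :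
  \sum_(j < #|{: {set 'I_n}}|) F (decode j) = \sum_A F A.
Proof.
rewrite [RHS]big_enum_val/=; apply: eq_bigr => j _.
by rewrite /decode valK.
Qed.

Lemma bern_measureE (B : pred {set 'I_n}) :
  (bern_measure [set j | B (decode j)] = (bernE pi (fun A => (B A)%:R))%:E)%E.
Proof.
rewrite /bern_measure /msum /bernE -(sum_decode (fun A => bern pi A * (B A)%:R)).
rewrite -sumEFin; apply: eq_bigr => j _.
transitivity
  ((bern pi (decode j))%:E * (\1_[set k | B (decode k)] (j : nat))%:E)%E => //.
rewrite EFinM indicE; congr (_ * _)%E.
case: (boolP (B (decode j))) => h; first by rewrite mem_set.
by rewrite memNset//; exact/negP.
Qed.

Lemma bern_measure_setT : bern_measure setT = 1%E.
Proof.
have -> : [set: nat] = [set j | xpredT (decode j)] by apply/seteqP.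
by rewrite (bern_measureE xpredT) bernE_cst.
Qed.

HB.instance Definition _ :=
  Measure_isProbability.Build _ _ _ bern_measure bern_measure_setT.

Lemma integral_bern_measure (F : {set 'I_n} -> R) : (forall A, 0 <= F A) ->
  (\int[bern_measure]_j (F (decode j))%:E = (bernE pi F)%:E)%E.
Proof.
move=> F0.
have mF : measurable_fun [set: nat] (fun j => (F (decode j))%:E) by move=> _ Y _.
rewrite ge0_integral_measure_sum//; last by move=> *; rewrite lee_fin.
rewrite /bernE -(sum_decode (fun A => bern pi A * F A)) -sumEFin.
apply: eq_bigr => j _; rewrite ge0_integral_mscale//; last first.
  by move=> *; rewrite lee_fin.
by rewrite integral_dirac// diracT mul1e.
Qed.

Variables (v0 v1 : 'I_n -> R).

Definition two_valued (i : 'I_n) (j : nat) : R :=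
  if i \in decode j then v1 i else v0 i.

Lemma measurable_two_valued i : measurable_fun [set: nat] (two_valued i).
Proof. by move=> _ Y _. Qed.

HB.instance Definition _ i :=
  isMeasurableFun.Build _ _ _ _ (two_valued i) (measurable_two_valued i).

Definition two_valued_rv (i : 'I_n) : {RV bern_measure >-> R} := two_valued i.

Lemma bernE_prod (F : 'I_n -> bool -> R) :
  bernE pi (fun A => \prod_i F i (i \in A)) =
  \prod_i (pi i * F i true + (1 - pi i) * F i false).
Proof.
rewrite bigA_distr; apply: eq_bigr => A _; rewrite /bern -big_split/=.
by apply: eq_bigr => i _; case: (i \in A).
Qed.

Lemma bernE_coord i (g : bool -> R) :
  bernE pi (fun A => g (i \in A)) = pi i * g true + (1 - pi i) * g false.
Proof.
transitivity (bernE pi (fun A => \prod_l (if l == i then g (l \in A) else 1))).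
  apply: eq_bernE => A; rewrite (bigD1 i)//= eqxx big1 ?mulr1// => l /negbTE -> //.
rewrite (bernE_prod (fun l x => if l == i then g x else 1)) (bigD1 i)//= eqxx.
rewrite big1 ?mulr1// => l /negbTE ->.
by rewrite !mulr1 addrC subrK.
Qed.

(** The indicator of the joint event is a product of functions of single coordinates, equal to [1]
    outside [J], so [bernE_prod] factors its expectation. *)
Lemma two_valued_independent : mutually_independent two_valued_rv.
Proof.
move=> J B mB.
pose b i (x : bool) : bool := `[< B i (if x then v1 i else v0 i) >].
pose c i := bernE pi (fun A => (b i (i \in A))%:R).
have probB i : bern_measure (two_valued_rv i @^-1` B i) = (c i)%:E.
  rewrite -bern_measureE; congr (bern_measure _).
  by apply/seteqP; split=> w /= /asboolP.
rewrite (eq_bigr _ (fun i _ => probB i)) prodEFin.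
rewrite (_ : [set w | _] = [set w | [forall (i | i \in J), b i (i \in decode w)]]).
  rewrite [LHS](bern_measureE (fun A => [forall (i | i \in J), b i (i \in A)])).
  congr (_%:E); transitivity (bernE pi (fun A =>
      \prod_i (if i \in J then (b i (i \in A))%:R else 1))).
    apply: eq_bernE => A.
    have [/forallP h|] := boolP [forall (i | i \in J), b i (i \in A)].
      by rewrite big1// => i _; case: ifP => // iJ; have := h i; rewrite iJ /= => ->.
    rewrite negb_forall => /existsP[i]; rewrite negb_imply => /andP[iJ /negbTE bi].
    by rewrite (bigD1 i)//= iJ bi mul0r.
  rewrite (bernE_prod (fun i x => if i \in J then (b i x)%:R else 1)).
  rewrite [RHS]big_mkcond; apply: eq_bigr => i _; case: ifP => _.
    by rewrite /c (bernE_coord i (fun x => (b i x)%:R)).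
  by rewrite !mulr1 addrC subrK.
apply/seteqP; split=> w /= h.
  by apply/forallP => i; apply/implyP => iJ; apply/asboolP; exact: h.
by move=> i iJ; have /forallP/(_ i) := h; rewrite iJ => /asboolP.
Qed.

Lemma expectation_two_valued i : 0 <= v0 i -> 0 <= v1 i ->
  ('E_bern_measure[two_valued_rv i] = (pi i * v1 i + (1 - pi i) * v0 i)%:E)%E.
Proof.
move=> v00 v10; rewrite expectation_def.
rewrite (integral_bern_measure (fun A => if i \in A then v1 i else v0 i)).
  by rewrite (bernE_coord i (fun x => if x then v1 i else v0 i)).
by move=> A; case: ifP.
Qed.

Lemma prob_sum_lt_two_valued (lambda : R) :
  prob_sum_lt lambda two_valued_rv =
  (bernE pi (fun A => (\sum_i (if i \in A then v1 i else v0 i) < lambda)%R%:R))%:E.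
Proof. by rewrite -bern_measureE. Qed.

End BernoulliSpace.

(** * Tail products as null probabilities of suffixes *)

Section TailProducts.
Context {R : realType} {n : nat}.
Variable mu : 'I_n -> R.
Hypothesis mu_ge0 : forall i, 0 <= mu i.

Lemma sum_lt_tail_gt0 (lambda : R) (k : 'I_n) : \sum_i mu i < lambda ->
  0 < lambda - \sum_(j < n | (j < k)%N) mu j.
Proof.
move=> lam; rewrite subr_gt0 (le_lt_trans _ lam)//.
by rewrite [leRHS](bigID (fun j : 'I_n => (j < k)%N))/= lerDl sumr_ge0.
Qed.

Lemma mu_lt_tail (lambda : R) (k i : 'I_n) : \sum_i mu i < lambda -> (k <= i)%N ->
  mu i < lambda - \sum_(j < n | (j < k)%N) mu j.
Proof.
move=> lam ki; rewrite ltrBrDr (le_lt_trans _ lam)//.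
rewrite [leRHS](bigID (fun j : 'I_n => (j < k)%N))/= [leLHS]addrC lerD2l.
by rewrite (bigD1 i)/= -?leqNgt// lerDl sumr_ge0.
Qed.

(** Adding the means from [k] on back to [lambda - \sum_i mu i] gives the denominator of the tail
    product; the factors before [k] are [1]. *)
Lemma tail_product_restr (lambda : R) (k : 'I_n) :
  null_prob (lambda - \sum_i mu i) (restr mu [set i : 'I_n | (k <= i)%N]%SET) =
  tail_product mu lambda k.
Proof.
rewrite /null_prob /tail_product [RHS]big_mkcond; apply: eq_bigr => i _.
have -> : lambda - \sum_i mu i +
    \sum_j restr mu [set i : 'I_n | (k <= i)%N]%SET j =
    lambda - \sum_(j < n | (j < k)%N) mu j.
  rewrite [\sum_i mu i](bigID (fun j : 'I_n => (j < k)%N))/= opprD addrA.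
  rewrite (_ : \sum_j restr _ _ j = \sum_(j < n | ~~ (j < k)%N) mu j) ?subrK//.
  by rewrite [RHS]big_mkcond; apply: eq_bigr => j _; rewrite /restr inE -leqNgt.
by rewrite /restr inE; case: ifP; rewrite // mul0r subr0.
Qed.

Lemma tail_product_le1 (lambda : R) (k : 'I_n) : \sum_i mu i < lambda ->
  tail_product mu lambda k <= 1.
Proof.
move=> lam; apply: prodr_ile1 => i ki; have L0 := sum_lt_tail_gt0 lambda k lam.
rewrite subr_ge0 ler_pdivrMr// mul1r (ltW (mu_lt_tail _ _ _ lam ki))/=.
by rewrite gerBl divr_ge0// ltW.
Qed.

Lemma tail_product_le_null_prob (lambda : R) m : (0 < n)%N ->
  (forall i j : 'I_n, (i <= j)%N -> mu i <= mu j) ->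
  \sum_i mu i < lambda -> (forall i, 0 <= m i <= mu i) ->
  exists k, tail_product mu lambda k <= null_prob (lambda - \sum_i mu i) m.
Proof.
move=> n0 mono lam mb; have d0 : 0 < lambda - \sum_i mu i by rewrite subr_gt0.
have [A leA] := null_prob_vertex _ _ _ d0 mb.
have [k lek] := null_prob_suffix _ _ A d0 mu_ge0 mono.
have [kn|nk] := ltnP k n.
  exists (Ordinal kn); rewrite -tail_product_restr (le_trans lek)//.
(* The empty suffix has null probability [1], which bounds every tail product. *)
exists (Ordinal n0); rewrite (le_trans (tail_product_le1 _ _ lam))//.
rewrite (le_trans _ leA)// (le_trans _ lek)// /null_prob big1// => i _.
rewrite /restr inE leqNgt (leq_trans (ltn_ord i) nk)/=.
by rewrite mul0r subr0.
Qed.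

Lemma tail_product_cvg (lambda : R) (k : 'I_n) : \sum_i mu i < lambda ->
  tail_product mu t k @[t --> lambda^'-] --> tail_product mu lambda k.
Proof.
move=> lam; apply: cvg_at_left_filter; rewrite /tail_product.
apply: cvg_big => [|j _]; first exact: mul_continuous.
apply: cvgB; first exact: cvg_cst.
apply: cvgMr; apply: cvgV; first by rewrite gt_eqF// sum_lt_tail_gt0.
by apply: cvgB; [exact: cvg_id|exact: cvg_cst].
Qed.

Lemma min_tail_productP (lambda : R) : (0 < n)%N ->
  exists2 k, min_tail_product mu lambda = (tail_product mu lambda k)%:E &
    forall l, tail_product mu lambda k <= tail_product mu lambda l.
Proof.
move=> n0; have [k _ kmin] :=
  @arg_minP _ _ _ (Ordinal n0) xpredT (tail_product mu lambda) isT.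
exists k => [|l]; last exact: kmin.
apply/eqP; rewrite eq_le /min_tail_product bigmin_le/=.
by apply/bigmin_geP; split => [|l _]; [exact: leey|rewrite lee_fin kmin].
Qed.

End TailProducts.

(** * Passage to the limit, extremal variables and conclusion *)

Lemma prob_sum_lt_tail_product (R : realType) (n : nat) (mu : 'I_n -> R) (lambda : R)
    (d : measure_display) (T : measurableType d) (P : probability T R)
    (X : 'I_n -> {RV P >-> R}) : (0 < n)%N ->
  (forall i, 0 <= mu i) -> (forall i j : 'I_n, (i <= j)%N -> mu i <= mu j) ->
  \sum_i mu i < lambda -> indep_nneg_with_means mu X ->
  exists k, ((tail_product mu lambda k)%:E <= prob_sum_lt lambda X)%E.
Proof.
move=> n0 mu_ge0 mono lam HX.
have below lambda' : \sum_i mu i < lambda' -> lambda' < lambda ->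
    exists k, ((tail_product mu lambda' k)%:E <= prob_sum_lt lambda X)%E.
  (* This mesh makes the total rounding loss [n%:R * h] equal to [lambda - lambda']. *)
  move=> lam' lt; pose h := (lambda - lambda') / n%:R.
  have nR0 : 0 < n%:R :> R by rewrite ltr0n.
  have h0 : 0 < h by rewrite divr_gt0 ?subr_gt0.
  have l0 : 0 <= lambda' / h.
    by rewrite divr_ge0 ?(ltW h0)// (le_trans _ (ltW lam'))// sumr_ge0.
  have [||//|m mb le] := prob_sum_lt_null_prob _ _ HX h
      (Num.truncn (lambda' / h)).+1 h0 lambda lambda'.
  - by rewrite -ler_pdivrMr// ltW//; have /andP[] := truncn_itv l0.
  - by rewrite /h mulrC divfK ?gt_eqF// addrC subrK.
  have [k lek] := tail_product_le_null_prob _ mu_ge0 _ _ n0 mono lam' mb.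
  by exists k; apply: le_trans le; rewrite lee_fin.
(* If all tail products at [lambda] exceeded the probability, then by continuity, there being
   finitely many, so would those at some [t < lambda] close to it, against [below]. *)
apply: contrapT => /forallNP none.
have pE : prob_sum_lt lambda X = (fine (prob_sum_lt lambda X))%:E.
  rewrite fineK// fin_num_measure// -[X in measurable X]setTI.
  rewrite (_ : [set w | _] = (fun w => \sum_(i < n) X i w) @^-1` `]-oo, lambda[).
    by apply: (measurable_sum _ (fun i => measurable_funP (X i))) => //.
  by apply/seteqP; split=> w; rewrite /= in_itv.
have near_gt : \forall t \near lambda^'-, forall k,
    fine (prob_sum_lt lambda X) < tail_product mu t k.
  apply: filter_forall => k; apply: (cvgr_gt _ (tail_product_cvg _ mu_ge0 _ k lam)).
  by have /negP := none k; rewrite -ltNge pE lte_fin.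
near lambda^'- => t.
have [||k] := below t; [by near: t; exact: nbhs_left_gt| |].
  by near: t; exact: nbhs_left_lt.
rewrite pE lee_fin leNgt => /negP; apply; move: k.
by near: t.
Unshelve. all: by end_near. Qed.

(** Variables before [k] are almost surely constant; the others are [0] or the whole remaining gap
    [L]. Almost surely, the sum stays below [lambda] exactly when all the latter vanish. *)
Lemma tail_product_attained (R : realType) (n : nat) (mu : 'I_n -> R) (lambda : R)
    (k : 'I_n) : (forall i, 0 <= mu i) -> \sum_i mu i < lambda ->
  exists (d : measure_display) (T : measurableType d) (P : probability T R)
    (X : 'I_n -> {RV P >-> R}),
    indep_nneg_with_means mu X /\
    prob_sum_lt lambda X = (tail_product mu lambda k)%:E.
Proof.
move=> mu_ge0 lam; set L := lambda - \sum_(j < n | (j < k)%N) mu j.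
have L0 : 0 < L by exact: sum_lt_tail_gt0.
pose pi (i : 'I_n) := if (k <= i)%N then mu i / L else 0.
pose v0 (i : 'I_n) := if (k <= i)%N then 0 else mu i.
have pi01 : unit_valued pi.
  move=> i; rewrite /pi; case: ifP => ki; last by rewrite lexx ler01.
  by rewrite divr_ge0 ?(ltW L0)//= ler_pdivrMr// mul1r ltW// mu_lt_tail.
have v00 i : 0 <= v0 i by rewrite /v0; case: ifP.
exists _, _, (bern_measure _ pi01), (two_valued_rv _ pi01 v0 (fun=> L)).
split; first split.
- exact: two_valued_independent.
- move=> i j; rewrite -[X in _ <= X]/(two_valued v0 (fun=> L) i j) /two_valued.
  by case: ifP => _ //; exact: ltW.
- move=> i; rewrite expectation_two_valued ?(ltW L0)//; congr EFin.
  rewrite /pi /v0; case: ifP => _; last by rewrite mul0r add0r subr0 mul1r.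
  by rewrite divfK ?gt_eqF// mulr0 addr0.
have sumv0 : \sum_i v0 i = \sum_(j < n | (j < k)%N) mu j.
  by rewrite [RHS]big_mkcond; apply: eq_bigr => i _; rewrite /v0 ltnNge; case: leqP.
rewrite prob_sum_lt_two_valued; congr EFin.
rewrite /bernE (bigD1 finset.set0)//= [X in _ + X]big1 => [|A /set0Pn[i iA]].
  rewrite addr0 (eq_bigr v0) => [|i _]; last by rewrite inE.
  rewrite sumv0 -subr_gt0 -/L L0 mulr1 /bern /tail_product [RHS]big_mkcond.
  by apply: eq_bigr => i _; rewrite inE /pi; case: ifP => _ //; rewrite subr0.
(* A set with an index before [k] has probability zero; for any other nonempty set, one value [L] on
   top of the constants already reaches [lambda]. *)
have [[j jA jk]|none] := pselect (exists2 j : 'I_n, j \in A & (j < k)%N).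
  by rewrite /bern (bigD1 j)//= jA /pi leqNgt jk/= !mul0r.
have kA j : j \in A -> (k <= j)%N.
  by move=> jA; rewrite leqNgt; apply/negP => jk; apply: none; exists j.
rewrite ltNge (_ : lambda <= _) ?mulr0//.
rewrite (bigD1 i)//= iA -lerBlDl (_ : lambda - L = \sum_i v0 i); last first.
  by rewrite sumv0 /L opprB addrC subrK.
rewrite (bigD1 i)//= {1}/v0 kA// add0r; apply: ler_sum => j _.
by case: ifP => // jA; rewrite /v0 kA// ltW.
Qed.

Theorem theorem1p1 (R : realType) (n : nat) (hn : (1 <= n)%N)
    (mu : 'I_n -> R) (lambda : R)
    (mu_ge0 : forall i, 0 <= mu i)
    (mu_mono : forall i j : 'I_n, (i <= j)%N -> mu i <= mu j)
    (lambda_gt : \sum_(i < n) mu i < lambda) :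
  c_inf mu lambda = min_tail_product mu lambda /\
  exists (d : measure_display) (T : measurableType d) (P : probability T R)
    (X : 'I_n -> {RV P >-> R}),
    indep_nneg_with_means mu X /\
    prob_sum_lt lambda X = min_tail_product mu lambda.
Proof.
have [k minE kmin] := min_tail_productP mu lambda hn.
have attained := tail_product_attained _ _ _ _ k mu_ge0 lambda_gt.
rewrite minE; split => //.
apply/eqP; rewrite eq_le; apply/andP; split.
  exact: ereal_inf_lbound.
apply: le_ereal_inf_tmp => _ [d [T [P [X [HX <-]]]]].
have [l lel] :=
  prob_sum_lt_tail_product _ _ _ _ _ _ _ _ hn mu_ge0 mu_mono lambda_gt HX.
by apply: le_trans lel; rewrite lee_fin kmin.
Qed.
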